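(* Assume that $\frac13<\alpha\le1$, that $\rho_0^\alpha\in H^3(I)$ and $C_1d(y)\le\rho_0^\alpha(y)\le C_2d(y)$ for all $y\in\bar I$ for some constants $C_1,C_2>0$, and that $\widetilde E(0,U)<\infty$; let $(\rho,u,\Gamma)$ be the global classical solution to the vacuum free boundary problem (VFBP) described in the context. Assume that $\big|\int_I\rho_0u_0\,\mathrm dy\big|>0$. Then $(\rho,u)$ does not satisfy $$\limsup_{t\to\infty}\ \sup_{y\in I(t)}|u(t,y)|=0.$$
   Context: $I=(0,1)$, $d(x)=\mathrm{dist}(x,\partial I)$, $|f|_p=\|f\|_{L^p(I)}$. $\rho_0\ge0$ on $\bar I$ and $u_0$ on $I$ are given initial data. Problem (VFBP): find an open bounded interval $I(t)\subset\mathbb R$ with boundary $\Gamma(t)=\partial I(t)$ and functions $\rho,u$ on $I(t)$ with $$\rho_t+(\rho u)_y=0,\quad (\rho u)_t+(\rho u^2+\rho^2)_y-(\rho u_y)_y=0,\quad \rho>0\ \text{ in }I(t),$$ $$\rho=0\ \text{ on }\Gamma(t),\qquad \mathcal V(\Gamma(t))=u\ \text{ on }\Gamma(t),\qquad (\rho,u)|_{t=0}=(\rho_0,u_0)\ \text{ on }I(0)=I,$$ where $\mathcal V(\Gamma(t))$ is the velocity of the moving boundary (each endpoint moves with velocity $u$). $\mathbb I(T)=\{(t,y): t\in(0,T],\ y\in I(t)\}$. A triple $(\rho,u,\Gamma)$ is a classical solution in $\overline{\mathbb I(T)}$ if $\rho,\rho_t,\rho_y,u,u_y,u_{yy},u_t\in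 C(\overline{\mathbb I(T)})$, $\Gamma(t)\in C^2([0,T])$, the two equations and $\rho>0$ hold pointwise in $\mathbb I(T)$, the initial data are attained, and the two boundary conditions hold continuously. The global classical solution: under the stated assumptions there is a unique triple $(\rho,u,\Gamma)$, defined for all $t\ge0$, that for every $T>0$ is a classical solution in $\overline{\mathbb I(T)}$ with $\sup_{t\in[0,T]}\big(\|\rho^\alpha\|_{W^{3,1}(I(t))}+\|(\rho^\alpha)_t\|_{W^{2,1}(I(t))}+\|u\|_{W^{3,1}(I(t))}+\|u_t\|_{W^{1,1}(I(t))}\big)<\infty$ and $u_y(t,y)=0$ for $t\in[0,T]$, $y\in\Gamma(t)$. $\varepsilon_0$ is a fixed number with: $0<\varepsilon_0\le\frac{3\alpha-1}{2\alpha}$ and $\varepsilon_0<\frac1\alpha-1$ if $\frac13<\alpha<1$; $0<\varepsilon_0<1$ if $\alpha=1$. Initial energy: set $U(0)=u_0$, $U_t(0)=\rho_0^{-1}\big[(\rho_0(u_0)_x)_x-(\rho_0^2)_x\big]$, $U_{tt}(0)=\rho_0^{-1}\big[(\rho_0U_{tx}(0))_x+2(\rho_0^2(u_0)_x)_x-2(\rho_0(u_0)_x^2)_x\big]$, and $$\widetilde E(0,U)=\sum_{k=0}^2|\rho_0^{1/2}\partial_t^kU(0)|_2^2+\sum_{k=0}^1|\rho_0^{1/2}\partial_t^kU_x(0)|_2^2+|\rho_0^{(\frac32-\varepsilon_0)\alpha}\partial_tU_{xx}(0)|_2^2+\sum_{k=2}^4|\rho_0^{(\frac32-\varepsilon_0)\alpha}\partial_x^ku_0|_2^2.$$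 *)

(* Defs.v *)
From HB Require Import structures.
From mathcomp Require Import all_boot all_order all_algebra.
From mathcomp Require Import all_classical all_reals all_analysis.

Set Implicit Arguments.
Unset Strict Implicit.
Unset Printing Implicit Defensive.

Import Order.TTheory GRing.Theory Num.Theory.
Import numFieldNormedType.Exports.

Local Open Scope classical_set_scope.
Local Open Scope ring_scope.

(* C_c^oo(D) *)
Definition test_function (R : realType) (D : set R) (phi : R -> R) : Prop :=
  [/\ forall (n : nat) (x : R), derivable (derive1n n phi) x 1,
      compact (closure [set x | phi x != 0]) &
      closure [set x | phi x != 0] `<=` D].

Definition is_weak_derivative (R : realType) (D : set R) (f g : R -> R) : Prop :=
  [/\ locally_integrable D f, locally_integrable D g &
      forall phi : R -> R, test_function D phi ->
        Rintegral lebesgue_measure D (fun x => f x * derive1 phi x) =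
        - Rintegral lebesgue_measure D (fun x => g x * phi x)].

(* A representative of the weak derivative of [f] on [D], which is unique up to
   a null set; its values outside [D] carry no information, and it is the zero
   function when [f] has no weak derivative on [D]. *)
Definition wD (R : realType) (D : set R) (f : R -> R) : R -> R :=
  xget (fun=> 0) [set g | is_weak_derivative D f g].

Definition wDn (R : realType) (D : set R) (k : nat) (f : R -> R) : R -> R :=
  iter k (wD D) f.

Definition weakly_differentiable (R : realType) (k : nat) (D : set R)
    (f : R -> R) : Prop :=
  locally_integrable D f /\
  forall j : nat, (j < k)%N -> is_weak_derivative D (wDn D j f) (wDn D j.+1 f).

Definition Lp_norm (R : realType) (p : R) (D : set R) (f : R -> R) : \bar R :=
  ('N[lebesgue_measure]_(p%:E)[EFin \o (f \_ D)])%E.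

(* The norm of W^{k,p}(D), equal to +oo when [f] is not in W^{k,p}(D). *)
Definition sobolev_norm (R : realType) (k : nat) (p : R) (D : set R)
    (f : R -> R) : \bar R :=
  (if `[< weakly_differentiable k D f >]
   then \sum_(j < k.+1) Lp_norm p D (wDn D j f) else +oo)%E.

Definition unit_itv (R : realType) : set R := `]0, 1[%classic.
Arguments unit_itv {R}.

(* The distance to the boundary {0, 1} of the unit interval. *)
Definition dist_bd (R : realType) (x : R) : R := Num.min `|x - 0| `|x - 1|.

Section InitialEnergy.
Context {R : realType} (rho0 u0 : R -> R).

Local Notation Dx := (wD unit_itv).

Definition Ut0 : R -> R := fun x =>
  (rho0 x)^-1 * (Dx (fun z => rho0 z * Dx u0 z) x - Dx (fun z => rho0 z ^+ 2) x).

Definition Utt0 : R -> R := fun x =>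
  (rho0 x)^-1 * (Dx (fun z => rho0 z * Dx Ut0 z) x
                 + 2 * Dx (fun z => rho0 z ^+ 2 * Dx u0 z) x
                 - 2 * Dx (fun z => rho0 z * Dx u0 z ^+ 2) x).

(* | rho0^beta f |_2^2 *)
Definition wnorm2 (beta : R) (f : R -> R) : \bar R :=
  (Lp_norm 2 unit_itv (fun x => rho0 x `^ beta * f x)%R ^+ 2)%E.

Definition initial_energy (alpha eps0 : R) : \bar R :=
  let beta := (3 / 2 - eps0) * alpha in
  ((wnorm2 (1 / 2) u0 + wnorm2 (1 / 2) Ut0 + wnorm2 (1 / 2) Utt0)
   + (wnorm2 (1 / 2) (Dx u0) + wnorm2 (1 / 2) (Dx Ut0))
   + wnorm2 beta (wDn unit_itv 2 Ut0)
   + \sum_(2 <= k < 5) wnorm2 beta (wDn unit_itv k u0))%E.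

(* All the weak derivatives that occur in [initial_energy] exist, so that none
   of them takes the default value of [wD]. *)
Definition initial_energy_defined : Prop :=
  [/\ weakly_differentiable 4 unit_itv u0,
      weakly_differentiable 1 unit_itv (fun z => rho0 z * Dx u0 z) /\
      weakly_differentiable 1 unit_itv (fun z => rho0 z ^+ 2),
      weakly_differentiable 2 unit_itv Ut0 &
      [/\ weakly_differentiable 1 unit_itv (fun z => rho0 z * Dx Ut0 z),
          weakly_differentiable 1 unit_itv (fun z => rho0 z ^+ 2 * Dx u0 z) &
          weakly_differentiable 1 unit_itv (fun z => rho0 z * Dx u0 z ^+ 2)]].

Definition finite_initial_energy (alpha eps0 : R) : Prop :=
  initial_energy_defined /\ (initial_energy alpha eps0 < +oo)%E.

End InitialEnergy.

Definition eps0_admissible (R : realType) (alpha eps0 : R) : Prop :=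
  (3^-1 < alpha < 1 ->
     [/\ 0 < eps0, eps0 <= (3 * alpha - 1) / (2 * alpha) & eps0 < alpha^-1 - 1])
  /\ (alpha = 1 -> 0 < eps0 < 1).

(* Derivative at [x] of [f] restricted to [A] (one-sided at an endpoint). *)
Definition quotient_within (R : realType) (A : set R) (f : R -> R) (x : R) :
    set_system R :=
  (fun z => (f z - f x) / (z - x)) @ within A x^'.

Definition derivable_within (R : realType) (A : set R) (f : R -> R) (x : R) :
    Prop := cvg (quotient_within A f x).

Definition derive_within (R : realType) (A : set R) (f : R -> R) (x : R) : R :=
  lim (quotient_within A f x).

Definition C2_segment (R : realType) (T : R) (f : R -> R) : Prop :=
  let J := `[0, T]%classic in
  let f1 := derive_within J f in
  let f2 := derive_within J f1 in
  [/\ forall t, J t -> derivable_within J f t,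
      forall t, J t -> derivable_within J f1 t &
      {within J, continuous f2}].

Section FreeBoundary.
Context {R : realType}.
(* I(t) = ]a t, b t[, so that Gamma(t) = {a t, b t}. *)
Variables (a b : R -> R).

Definition It (t : R) : set R := `]a t, b t[%classic.

Definition Gamma (t : R) : set R := [set a t; b t].

Definition IT (T : R) : set (R * R) :=
  [set p | 0 < p.1 <= T /\ It p.1 p.2].

Definition times (T y : R) : set R := [set s | 0 <= s <= T /\ It s y].

Definition dt (T : R) (f : R -> R -> R) (t y : R) : R :=
  derive_within (times T y) (f^~ y) t.

Definition t_derivable (T : R) (f : R -> R -> R) : Prop :=
  forall t y, IT T (t, y) -> derivable_within (times T y) (f^~ y) t.

Definition dy (f : R -> R -> R) (t y : R) : R := derive1 (f t) y.

Definition y_derivable (T : R) (f : R -> R -> R) : Prop :=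
  forall t y, IT T (t, y) -> derivable (f t) y 1.

(* A function given on I(T) belongs to C(closure I(T)): it is the restriction
   of a function which is continuous on the closure. *)
Definition C_closure (T : R) (f : R -> R -> R) : Prop :=
  exists2 g : R * R -> R,
    {within closure (IT T), continuous g} &
    forall t y, IT T (t, y) -> g (t, y) = f t y.

Record classical_solution (T : R) (rho0 u0 : R -> R) (rho u : R -> R -> R) :
    Prop := ClassicalSolution {
  cs_interval : forall t, 0 <= t <= T -> a t < b t;
  cs_C2 : C2_segment T a /\ C2_segment T b;
  (* rho and u themselves are defined, and continuous, up to the boundary. *)
  cs_rho : {within closure (IT T), continuous (fun p => rho p.1 p.2)};
  cs_rho_t : t_derivable T rho /\ C_closure T (dt T rho);
  cs_rho_y : y_derivable T rho /\ C_closure T (dy rho);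
  cs_u : {within closure (IT T), continuous (fun p => u p.1 p.2)};
  cs_u_t : t_derivable T u /\ C_closure T (dt T u);
  cs_u_y : y_derivable T u /\ C_closure T (dy u);
  cs_u_yy : y_derivable T (dy u) /\ C_closure T (dy (dy u));
  cs_mass : forall t y, IT T (t, y) ->
    dt T rho t y + dy (fun s z => rho s z * u s z) t y = 0;
  cs_momentum : forall t y, IT T (t, y) ->
    dt T (fun s z => rho s z * u s z) t y
    + dy (fun s z => rho s z * u s z ^+ 2 + rho s z ^+ 2) t y
    - dy (fun s z => rho s z * dy u s z) t y = 0;
  cs_rho_gt0 : forall t y, IT T (t, y) -> 0 < rho t y;
  cs_vacuum : forall t y, 0 <= t <= T -> Gamma t y -> rho t y = 0;
  cs_velocity : forall t, 0 <= t <= T ->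
    derive_within `[0, T]%classic a t = u t (a t) /\
    derive_within `[0, T]%classic b t = u t (b t);
  cs_init_interval : a 0 = 0 /\ b 0 = 1;
  cs_init : forall y, It 0 y -> rho 0 y = rho0 y /\ u 0 y = u0 y }.

Definition regularity_norm (alpha T : R) (rho u : R -> R -> R) (t : R) :
    \bar R :=
  let rho_alpha := fun s z => rho s z `^ alpha in
  (sobolev_norm 3 1 (It t) (rho_alpha t)
   + sobolev_norm 2 1 (It t) (dt T rho_alpha t)
   + sobolev_norm 3 1 (It t) (u t)
   + sobolev_norm 1 1 (It t) (dt T u t))%E.

(* The boundary values of u_y are those of its continuous extension. *)
Definition global_classical_solution (alpha : R) (rho0 u0 : R -> R)
    (rho u : R -> R -> R) : Prop :=
  forall T : R, 0 < T ->
    [/\ classical_solution T rho0 u0 rho u,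
        (ereal_sup [set regularity_norm alpha T rho u t | t in `[0%R, T]%classic]
           < +oo)%E &
        forall t y, 0 <= t <= T -> Gamma t y ->
          dy u p.1 p.2 @[p --> within (IT T) (nbhs (t, y))] --> (0 : R)].

End FreeBoundary.

(* Main.v *)
Require Import Defs.
From HB Require Import structures.
From mathcomp Require Import all_boot all_order all_algebra.
From mathcomp Require Import all_classical all_reals all_analysis.
From mathcomp Require Import ring lra.
Import Order.TTheory GRing.Theory Num.Theory.
Import numFieldNormedType.Exports.
Local Open Scope classical_set_scope.
Local Open Scope ring_scope.

(** Mass and momentum are conserved: both are integrals over the moving interval
    [a t, b t] of a density f with f_t + F_y = 0, where f vanishes and F tends to
    0 at the moving boundary (since rho = 0 there and u_y -> 0).  Hence
    |P| = |int rho u| <= sup |u(t, .)| * mass for all t, and sup |u(t, .)| cannot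
    become small when the initial momentum P is nonzero.

    Conservation needs no transport theorem.  If a and b are Lipschitz at t with
    constant K, then for s at distance h of t the interval
    [a t + (K+1)h, b t - (K+1)h] lies in both domains and in those of all
    intermediate times; on it the mass changes by the flux difference, which is
    o(h), and the remaining boundary layers have width O(h) and carry a density
    o(1).  So the mass has derivative 0. *)

(** * Continuity on subsets of a product *)

Lemma continuous_pair (T U V : topologicalType) (f : T -> U) (g : T -> V) :
  continuous f -> continuous g -> continuous (fun x => (f x, g x)).
Proof. by move=> cf cg x; exact: (cvg_pair (cf x) (cg x)). Qed.

(** Serves to restrict a function continuous on a region of the plane to a slice at fixed time or at
    fixed position. *)
Lemma within_continuous_precomp (T U V : topologicalType) (A : set T)
    (B : set U) (g : T -> U) (f : U -> V) :
  continuous g -> (forall x, A x -> B (g x)) ->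
  {within B, continuous f} -> {within A, continuous (f \o g)}.
Proof.
move=> cg AB /subspace_continuousP cf; apply/subspace_continuousP => x Ax.
apply: cvg_trans (cf _ (AB _ Ax)) => W /= N.
have /cg : nbhs (g x) [set z | B z -> W (f z)] by [].
rewrite nbhs_simpl /within /=; apply: filterS => z /= + Az; apply; exact: AB.
Qed.

(** * Integrals of continuous functions over segments *)

Section segment_integral.
Context {R : realType}.
Local Notation mu := (@lebesgue_measure R).
Implicit Types (f : R -> R) (p q r : R).

Lemma continuous_segment_integrable f p q :
  {within `[p, q], continuous f} -> mu.-integrable `[p, q] (EFin \o f).
Proof.
by move=> cf; apply: continuous_compact_integrable => //; exact: segment_compact.
Qed.

Lemma Rintegral_segment_split f p q r : p <= q -> q <= r ->
  {within `[p, r], continuous f} ->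
  \int[mu]_(x in `[p, r]) f x =
  \int[mu]_(x in `[p, q]) f x + \int[mu]_(x in `[q, r]) f x.
Proof.
move=> pq qr cf.
have if_ := continuous_segment_integrable _ _ _ cf.
have -> : \int[mu]_(x in `[q, r]) f x = \int[mu]_(x in `]q, r]) f x.
  rewrite Rintegral_itv_obnd_cbnd//.
  apply: integrableS if_ => //=.
  by apply: subset_itvr; rewrite bnd_simp.
by rewrite -(Rintegral_itvB (x := q) if_) ?bnd_simp// addrC subrK.
Qed.

Lemma le_normr_Rintegral_segment f p q (e : R) : p <= q ->
  {within `[p, q], continuous f} ->
  (forall x, p <= x <= q -> `|f x| <= e) ->
  `|\int[mu]_(x in `[p, q]) f x| <= e * (q - p).
Proof.
move=> pq cf fe.
have if_ := continuous_segment_integrable _ _ _ cf.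
apply: (le_trans (le_normr_Rintegral _ if_)) => //.
have -> : e * (q - p) = \int[mu]_(x in `[p, q]) e.
  by rewrite Rintegral_cst//= lebesgue_measure_itv /= lte_fin;
    case: ltgtP pq => // -> _; rewrite subrr.
apply: le_Rintegral => //=.
- exact: (integrable_norm if_).
- by apply: continuous_segment_integrable; exact/continuous_subspaceT/cst_continuous.
Qed.

End segment_integral.

(** * Balance law on a fixed space-time rectangle *)

Section rectangle.
Context {R : realType}.
Local Notation mu := (@lebesgue_measure R).

Lemma compact_norm_bound (T : topologicalType) (A : set T) (g : T -> R) :
  compact A -> {within A, continuous g} ->
  exists2 M, 0 <= M & forall x, A x -> `|g x| <= M.
Proof.
move=> cA cg.
have /compact_bounded[M [_ gM]] := continuous_compact cg cA.
exists (`|M| + 1); first by rewrite addr_ge0.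
move=> x Ax; apply: (gM (`|M| + 1)); last by exists x.
by rewrite (le_lt_trans (ler_norm M))// ltrDl.
Qed.

Variables (f ft F : R -> R -> R) (s1 s2 c d e : R).
Hypotheses (s12 : s1 < s2) (cd : c < d).
Hypothesis cf :
  {within `[s1, s2] `*` `[c, d], continuous (fun p => f p.1 p.2)}.
Hypothesis dft : forall s y, s1 < s < s2 -> c <= y <= d ->
  is_derive s (1 : R) (f^~ y) (ft s y).
Hypothesis cft : forall s y, s1 < s < s2 -> c <= y <= d ->
  {for (s, y), continuous (fun p => ft p.1 p.2)}.
Hypothesis dF : forall s y, s1 < s < s2 -> c <= y <= d ->
  is_derive y (1 : R) (F s) (- ft s y).
Hypothesis Fe : forall s, s1 < s < s2 -> `|F s d - F s c| <= e.

Let Phi s := \int[mu]_(y in `[c, d]) f s y.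

Let slice s : s1 <= s <= s2 -> {within `[c, d], continuous (f s)}.
Proof.
move=> hs; pose g (y : R) := (s, y).
have cg : continuous g.
  by apply: continuous_pair; [exact: cst_continuous|by move=> ?; exact: cvg_id].
apply: (@within_continuous_precomp _ _ _ _ (`[s1, s2] `*` `[c, d]) g
  (fun p => f p.1 p.2)) => //.
Qed.

Let cPhi : {within `[s1, s2], continuous Phi}.
Proof.
(* Clamping the time to [[s1, s2]] extends the integrand to all times. Continuity under the integral
   sign, applied on the larger open interval []s1 - 1, s2 + 1[], then gives continuity of [Phi] up
   to the endpoints [s1] and [s2]. *)
pose cl s := Num.min s2 (Num.max s1 s).
have clE s : s1 <= cl s <= s2.
  by rewrite /cl le_min ge_min le_max lexx/= (ltW s12) lexx.
have cl_id s : s1 <= s <= s2 -> cl s = s.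
  by move=> /andP[h1 h2]; rewrite /cl (max_r h1) (min_r h2).
have ccl : continuous cl.
  move=> s; apply: continuous_min; first exact: cst_continuous.
  by apply: continuous_max; first exact: cst_continuous.
have [M M0 fM] := compact_norm_bound _ _ _
  (compact_setX (@segment_compact _ s1 s2) (@segment_compact _ c d)) cf.
have /= cPhicl := @continuity_under_integral R _ _ mu (fun s y => f (cl s) y)
  `[c, d] (measurable_itv _) (s1 - 1) (s2 + 1) _ _ (cst M) _ _.
apply: (@subspace_eq_continuous _ _ _ (Phi \o cl)).
  by move=> s /set_mem; rewrite /= in_itv/= => /cl_id ->.
apply: continuous_in_subspaceT => s /set_mem; rewrite /= in_itv/= => /andP[h1 h2].
apply: cPhicl.
- by move=> x _; apply: continuous_segment_integrable; exact: slice.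
- apply: aeW => y /=; rewrite in_itv/= => hy x _.
  apply: (@within_continuous_continuous _ _ _ (x - 1) (x + 1)); last 2 first.
    pose g s0 := (cl s0, y).
    have cg : continuous g by apply: continuous_pair => //; exact: cst_continuous.
    apply: (@within_continuous_precomp _ _ _ _ (`[s1, s2] `*` `[c, d]) g
  (fun p => f p.1 p.2)) => //.
    by move=> z _; rewrite /= !in_itv/= clE.
    by rewrite in_itv/= ltrBlDr ltrDl ltr01.
  by rewrite ltrBlDr -addrA ltrDl.
- by apply: continuous_segment_integrable; exact/continuous_subspaceT/cst_continuous.
- move=> x _; apply: aeW => y /=; rewrite in_itv/= => hy.
  by apply: (fM (cl x, y)); split; rewrite /= in_itv/=.
- by rewrite inE/= in_itv/=; apply/andP; split; lra.
Qed.

(** Differentiation under the integral sign gives the integral of [ft s], and since [- F s] is a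
    primitive of [ft s] the fundamental theorem of calculus turns it into a difference of fluxes. *)
Let dPhi s : s \in `]s1, s2[%R -> is_derive s 1 Phi (F s c - F s d).
Proof.
(* With this radius the closed interval around [s] stays inside []s1, s2[]. There [ft] is continuous
   on a compact rectangle, so a constant [M] dominates it. *)
rewrite in_itv/= => /andP[h1 h2].
pose r := Num.min (s - s1) (s2 - s) / 2.
have r0 : 0 < r by rewrite divr_gt0// lt_min !subr_gt0 h1.
have rs x : s - r <= x <= s + r -> s1 < x < s2.
  have : r < s - s1 /\ r < s2 - s.
    split.
    - by rewrite (@lt_le_trans _ _ (Num.min (s - s1) (s2 - s)))// ?gt_min ?lexx//
        ?ltr_pdivrMr ?ltr_pMr ?lt_min ?subr_gt0 ?h1 ?ltr1n// ge_min lexx.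
    - by rewrite (@lt_le_trans _ _ (Num.min (s - s1) (s2 - s)))// ?gt_min ?lexx//
        ?ltr_pdivrMr ?ltr_pMr ?lt_min ?subr_gt0 ?h1 ?ltr1n// ge_min lexx orbT.
  by move=> [? ?] /andP[? ?]; apply/andP; split; lra.
have [M M0 ftM] : exists2 M, 0 <= M & forall p,
    (`[s - r, s + r] `*` `[c, d]) p -> `|ft p.1 p.2| <= M.
  apply: (@compact_norm_bound _ _ (fun p => ft p.1 p.2)).
    by apply: compact_setX; exact: segment_compact.
  apply: continuous_in_subspaceT => -[x y] /set_mem[/=].
  by rewrite !in_itv/= => /rs hx hy; exact: cft.
have Is : `]s - r, s + r[%classic s by rewrite /= in_itv/=; apply/andP; split; lra.
have sub x : `]s - r, s + r[%classic x -> s1 < x < s2.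
  by rewrite /= in_itv/= => /andP[? ?]; apply: rs; rewrite !ltW.
have intf x : `]s - r, s + r[%classic x -> mu.-integrable `[c, d] (EFin \o f x).
  move=> /sub/andP[? ?]; apply: continuous_segment_integrable; apply: slice.
  by rewrite !ltW.
have derf x y : `]s - r, s + r[%classic x -> `[c, d]%classic y ->
    derivable (f ^~ y) x 1.
  by move=> /sub hx; rewrite /= in_itv/= => hy; have [] := dft x y hx hy.
have ftE x y : `]s - r, s + r[%classic x -> `[c, d]%classic y ->
    partial1of2 f x y = ft x y.
  move=> /sub hx; rewrite /= in_itv/= => hy.
  by rewrite partial1of2E; have [_ ->] := dft x y hx hy.
have intM : mu.-integrable `[c, d] (EFin \o cst M).
  by apply: continuous_segment_integrable; exact/continuous_subspaceT/cst_continuous.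
have Gub x y : `]s - r, s + r[%classic x -> `[c, d]%classic y ->
    `|partial1of2 f x y| <= cst M y.
  move=> hx hy; rewrite ftE//; apply: (ftM (x, y)); split => //=.
  by apply: subset_itv_oo_cc hx.
have mcd := measurable_itv `[c, d] : measurable `[c, d]%classic.
have dP := @derivable_under_integral R _ _ mu f _ mcd s _ _ Is intf derf
  (cst M) (fun=> M0) intM Gub.
have := @differentiation_under_integral R _ _ mu f _ mcd s _ _ Is intf derf
  (cst M) (fun=> M0) intM Gub.
rewrite derive1E => DP.
split; first exact: dP.
rewrite [LHS]DP.
have hs : s1 < s < s2 by rewrite h1.
transitivity (\int[mu]_(y in `[c, d]) ft s y).
  by apply: eq_Rintegral => y /set_mem hy; exact: ftE.
have dNF y : c <= y <= d -> is_derive y (1:R) (- F s) (ft s y).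
  by move=> hy; have := dF s y hs hy => ?; rewrite -[ft s y]opprK; exact: is_deriveN.
rewrite /Rintegral (@continuous_FTC2 _ _ (- F s))//.
- by rewrite /= opprK addrC.
- apply: continuous_in_subspaceT => y /set_mem; rewrite /= in_itv/= => hy.
  pose g (y : R) := (s, y).
  apply: (@continuous_comp _ _ _ g (fun p => ft p.1 p.2)); last exact: cft.
  by move: y {hy}; apply: continuous_pair;
    [exact: cst_continuous|by move=> ?; exact: cvg_id].
- have cNF y : c <= y <= d -> {for y, continuous (- F s)}.
    by move=> /dNF[? _]; exact/differentiable_continuous/derivable1_diffP.
  split.
  + by move=> y; rewrite in_itv/= => /andP[? ?]; have [|//] := dNF y _; rewrite !ltW.
  + by apply: cvg_at_right_filter; apply: cNF; rewrite lexx ltW.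
  + by apply: cvg_at_left_filter; apply: cNF; rewrite lexx ltW.
- move=> y; rewrite in_itv/= => /andP[? ?].
  by rewrite derive1E; have [|//] := dNF y _; rewrite !ltW.
Qed.

(** Mean value theorem for [Phi]. The intermediate time is strictly between [s1] and [s2], so the
    flux is never evaluated at [s1], which may be the initial time. *)
Lemma rectangle_mass_variation :
  `|\int[mu]_(y in `[c, d]) f s2 y - \int[mu]_(y in `[c, d]) f s1 y|
    <= e * (s2 - s1).
Proof.
have [s ss ->] := MVT s12 dPhi cPhi.
rewrite normrM [`|s2 - s1|]gtr0_norm ?subr_gt0// ler_wpM2r//.
  by rewrite subr_ge0 ltW.
by rewrite distrC; apply: Fe; move: ss; rewrite in_itv.
Qed.

End rectangle.

(** Here [x] and [z] stand for the two boundary layers and [y] for the middle segment, each at two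
    times. Four layers of size [2 * p + q] and a middle variation of [2 * q] add up to
    [8 * p + 6 * q]. *)
Lemma three_pieces_bound (R : realType) (x1 x2 y1 y2 z1 z2 p q : R) :
  `|x1| <= 2 * p + q -> `|x2| <= 2 * p + q ->
  `|z1| <= 2 * p + q -> `|z2| <= 2 * p + q -> `|y2 - y1| <= 2 * q ->
  `|x2 + y2 + z2 - (x1 + y1 + z1)| <= 8 * p + 6 * q.
Proof.
rewrite !ler_norml.
by do 5! move=> /andP[? ?]; apply/andP; split; lra.
Qed.

Lemma normr_max0B (R : realType) (x y : R) :
  `|Num.max 0 x - Num.max 0 y| <= `|x - y|.
Proof.
rewrite ler_norml; have := ler_norm (x - y); have := ler_norm (- (x - y)).
rewrite normrN; case: (lerP 0 x) => ?; case: (lerP 0 y) => ? ? ?.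
all: by apply/andP; split; lra.
Qed.

(** * Conservation over a moving interval *)

Section moving_interval.
Context {R : realType}.
Local Notation mu := (@lebesgue_measure R).
Variables (a b : R -> R) (f ft F : R -> R -> R).

(** The initial time belongs to the closed region but not to the open one: continuity holds down to
    time 0, the differential relations only at positive times. *)
Definition closed_region : set (R * R) :=
  [set p | 0 <= p.1 /\ a p.1 <= p.2 <= b p.1].
Definition open_region : set (R * R) :=
  [set p | 0 < p.1 /\ a p.1 < p.2 < b p.1].

(** Only increments from the fixed time [t] are compared, so that derivability at [t], possibly
    one-sided, is enough. *)
Definition locally_lipschitz (g : R -> R) (t : R) : Prop :=
  exists2 K, 0 <= K & \forall s \near t, 0 <= s -> `|g s - g t| <= K * `|s - t|.

Hypothesis ab : forall t : R, 0 <= t -> a t < b t.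
Hypothesis lip_a : forall t : R, 0 <= t -> locally_lipschitz a t.
Hypothesis lip_b : forall t : R, 0 <= t -> locally_lipschitz b t.
Hypothesis cf : {within closed_region, continuous (fun p => f p.1 p.2)}.
Hypothesis dft : forall s y, open_region (s, y) ->
  is_derive s (1 : R) (f^~ y) (ft s y).
Hypothesis cft : forall s y, open_region (s, y) ->
  {for (s, y), continuous (fun p => ft p.1 p.2)}.
Hypothesis dF : forall s y, open_region (s, y) ->
  is_derive y (1 : R) (F s) (- ft s y).
Hypothesis f0 : forall t z : R, 0 <= t -> z = a t \/ z = b t -> f t z = 0.
Hypothesis F0 : forall t z : R, 0 <= t -> z = a t \/ z = b t ->
  F p.1 p.2 @[p --> within open_region (nbhs (t, z))] --> (0 : R).

(** With [rho] for [f] this is the mass, with [rho * u] the momentum. *)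
Definition region_mass (t : R) := \int[mu]_(y in `[a t, b t]) f t y.

Let small_near (t z e r : R) := forall s y : R, `|s - t| < r -> `|y - z| < r ->
  (closed_region (s, y) -> `|f s y| <= e) /\
  (open_region (s, y) -> `|F s y| <= e).

Let boundary_small (t z e : R) : 0 <= t -> z = a t \/ z = b t -> 0 < e ->
  exists2 r, 0 < r & small_near t z e r.
Proof.
move=> t0 zab e0.
have Dtz : closed_region (t, z).
  by split => //=; case: zab => ->; rewrite lexx ltW ?ab.
have h1 : nbhs (t, z) [set p | open_region p -> `|0 - F p.1 p.2| <= e].
  by have /cvgrPdist_le/(_ _ e0) := F0 t z t0 zab.
have h2 : nbhs (t, z) [set p | closed_region p -> `|f t z - f p.1 p.2| <= e].
  by have /subspace_continuousP/(_ _ Dtz)/cvgrPdist_le/(_ _ e0) := cf.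
have : nbhs (t, z) [set p | (closed_region p -> `|f p.1 p.2| <= e) /\
  (open_region p -> `|F p.1 p.2| <= e)].
  apply: filterS2 h1 h2 => p /= h1 h2; split.
    by move=> /h2; rewrite f0// sub0r normrN.
  by move=> /h1; rewrite sub0r normrN.
move=> /nbhs_ballP[r /= r0 hr]; exists r => // s y st yz.
by apply: (hr (s, y)); split; rewrite /ball/= distrC.
Qed.

Lemma region_slice_continuous (s : R) : 0 <= s ->
  {within `[a s, b s], continuous (f s)}.
Proof.
move=> hs; pose g (y : R) := (s, y).
have cg : continuous g.
  by apply: continuous_pair; [exact: cst_continuous|by move=> ?; exact: cvg_id].
by apply: (@within_continuous_precomp _ _ _ _ closed_region g (fun p => f p.1 p.2)).
Qed.

(** The factor [8 * K + 6]: two layers at each of two times, of width at most [(2 * K + 1) * h],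
    contribute [8 * K + 4], and the fluxes through the two ends of the middle segment contribute
    2. *)
Let mass_variation (t s1 s2 K e r : R) :
  0 <= s1 -> s1 < s2 -> s1 <= t <= s2 -> 0 <= K ->
  (forall s : R, s1 <= s <= s2 -> `|a s - a t| <= K * (s2 - s1)) ->
  (forall s : R, s1 <= s <= s2 -> `|b s - b t| <= K * (s2 - s1)) ->
  (K + 1) * (s2 - s1) < r -> 2 * ((K + 1) * (s2 - s1)) < b t - a t ->
  small_near t (a t) e r -> small_near t (b t) e r ->
  `|region_mass s2 - region_mass s1| <= (e * (8 * K + 6)) * (s2 - s1).
Proof.
move=> s10 s12 /andP[s1t ts2] K0 Ka Kb hr hab sma smb.
set h := s2 - s1 in Ka Kb hr hab *.
have h0 : 0 < h by rewrite subr_gt0.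
have Kh0 : 0 <= K * h by rewrite mulr_ge0// ltW.
rewrite mulrDl mul1r in hr hab.
(* The sign of [e] comes from the point [(t, a t)], where [e] bounds an absolute value. *)
have e0 : 0 <= e.
  have t0 : 0 <= t by rewrite (le_trans s10).
  have r0 : 0 < r by lra.
  have [|| + _] := sma t (a t); rewrite ?subrr ?normr0// => H.
  by apply: le_trans (H _) => //; split; rewrite //= lexx ltW ?ab.
(* The endpoints move by at most [K * h]. The extra [h] makes the inclusion of [[c, d]] in every []a
   s, b s[] strict. *)
pose c := a t + (K * h + h); pose d := b t - (K * h + h).
have cd : c < d by rewrite /c /d; lra.
have time_near (s : R) : s1 <= s <= s2 -> `|s - t| < r.
  move=> /andP[? ?]; rewrite ltr_norml; apply/andP; rewrite /h in hr Kh0; split; lra.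
have ac (s : R) : s1 <= s <= s2 -> a t - K * h <= a s /\ a s < c.
  move=> /Ka; rewrite ler_norml /c => /andP[? ?]; split; lra.
have db (s : R) : s1 <= s <= s2 -> d < b s /\ b s <= b t + K * h.
  move=> /Kb; rewrite ler_norml /d => /andP[? ?]; split; lra.
have inO (s y : R) : s1 < s < s2 -> c <= y <= d -> open_region (s, y).
  move=> /andP[hs1 hs2] /andP[cy yd].
  have hs : s1 <= s <= s2 by rewrite !ltW.
  split => /=; first by rewrite (le_lt_trans s10).
  have [_ ?] := ac s hs; have [? _] := db s hs; apply/andP; split; lra.
(* The points [c] and [d] are at distance [(K + 1) * h < r] from [a t] and [b t], so the flux is at
   most [e] at each of them. *)
have mid : `|\int[mu]_(y in `[c, d]) f s2 y - \int[mu]_(y in `[c, d]) f s1 y|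
    <= (2 * e) * h.
  apply: (@rectangle_mass_variation _ f ft F) => //.
  - apply: continuous_subspaceW cf => -[s y] [/=]; rewrite !in_itv/=.
    move=> hs /andP[cy yd]; have [h1 _] := andP hs; split => /=.
      by rewrite (le_trans s10).
    have [_ ?] := ac s hs; have [? _] := db s hs; apply/andP; split; lra.
  - by move=> s y hs hy; exact/dft/inO.
  - by move=> s y hs hy; exact/cft/inO.
  - by move=> s y hs hy; exact/dF/inO.
  - move=> s hs; have /andP[hs1 hs2] := hs.
    have ts : `|s - t| < r by apply: time_near; rewrite !ltW.
    rewrite (le_trans (ler_normB _ _))// mulr2n mulrDl !mul1r lerD//.
    + apply: (smb s d ts _).2; last by apply: inO => //; rewrite lexx ltW.
      by rewrite /d addrC addKr normrN ger0_norm; lra.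
    + apply: (sma s c ts _).2; last by apply: inO => //; rewrite lexx ltW.
      by rewrite /c addrC addKr ger0_norm; lra.
have left_layer (s : R) : s1 <= s <= s2 ->
    `|\int[mu]_(y in `[a s, c]) f s y| <= e * ((2 * K + 1) * h).
  move=> hs; have [ha hc] := ac s hs; have [hd hb] := db s hs.
  have /andP[hs1 hs2] := hs.
  have s0 : 0 <= s by rewrite (le_trans s10).
  apply: (@le_trans _ _ (e * (c - a s))); last first.
    by rewrite ler_wpM2l// /c mulrDl -mulrA mul1r; lra.
  apply: le_normr_Rintegral_segment; first exact: ltW.
    apply: continuous_subspaceW (region_slice_continuous s s0) => y /=.
    rewrite !in_itv/=.
    by move=> /andP[-> yc]; rewrite (le_trans yc)// ltW// (lt_trans cd).
  move=> y /andP[ay yc]; apply: (sma s y _ _).1; first exact: time_near.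
    by rewrite ltr_norml; apply/andP; rewrite /c in yc; split; lra.
  by split => //=; rewrite ay (le_trans yc)// ltW// (lt_trans cd).
have right_layer (s : R) : s1 <= s <= s2 ->
    `|\int[mu]_(y in `[d, b s]) f s y| <= e * ((2 * K + 1) * h).
  move=> hs; have [ha hc] := ac s hs; have [hd hb] := db s hs.
  have /andP[hs1 hs2] := hs.
  have s0 : 0 <= s by rewrite (le_trans s10).
  apply: (@le_trans _ _ (e * (b s - d))); last first.
    by rewrite ler_wpM2l// /d mulrDl -mulrA mul1r; lra.
  apply: le_normr_Rintegral_segment; first exact: ltW.
    apply: continuous_subspaceW (region_slice_continuous s s0) => y /=.
    rewrite !in_itv/=.
    by move=> /andP[dy ->]; rewrite (le_trans _ dy)// ltW// (lt_trans hc).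
  move=> y /andP[dy yb]; apply: (smb s y _ _).1; first exact: time_near.
    by rewrite ltr_norml; apply/andP; rewrite /d in dy; split; lra.
  by split => //=; rewrite yb (le_trans _ dy)// ltW// (lt_trans hc).
have split_mass (s : R) : s1 <= s <= s2 -> region_mass s =
    \int[mu]_(y in `[a s, c]) f s y + \int[mu]_(y in `[c, d]) f s y
    + \int[mu]_(y in `[d, b s]) f s y.
  move=> hs; have [ha hc] := ac s hs; have [hd hb] := db s hs.
  have s0 : 0 <= s by have /andP[hs1 _] := hs; rewrite (le_trans s10).
  rewrite /region_mass (@Rintegral_segment_split _ _ _ c); first last.
  - exact: region_slice_continuous.
  - by rewrite ltW// (lt_trans cd).
  - exact: ltW.
  rewrite -addrA (@Rintegral_segment_split _ _ c d)//; first exact: ltW.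
    exact: ltW.
  apply: continuous_subspaceW (region_slice_continuous s s0) => y /=.
    rewrite !in_itv/=.
  by move=> /andP[cy ->]; rewrite (le_trans _ cy)// ltW.
have hs1 : s1 <= s1 <= s2 by rewrite lexx ltW.
have hs2 : s1 <= s2 <= s2 by rewrite lexx ltW.
rewrite !split_mass//.
have X : e * ((2 * K + 1) * h) = 2 * (e * (K * h)) + e * h by ring.
have -> : e * (8 * K + 6) * h = 8 * (e * (K * h)) + 6 * (e * h) by ring.
by apply: three_pieces_bound; rewrite -?X; [exact: left_layer|
  exact: left_layer|exact: right_layer|exact: right_layer|rewrite mulrA].
Qed.

(** This expresses that [region_mass] has derivative 0 at [t] relative to nonnegative times. *)
Let mass_variation_near (t e : R) : 0 <= t -> 0 < e -> \forall s \near t, 0 <= s ->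
  `|region_mass s - region_mass t| <= e * `|s - t|.
Proof.
move=> t0 e0.
have [Ka Ka0 lipa] := lip_a t t0.
have [Kb Kb0 lipb] := lip_b t t0.
pose K := Ka + Kb.
have K0 : 0 <= K by rewrite addr_ge0.
pose e' := e / (8 * K + 6).
have K6 : 0 < 8 * K + 6 by lra.
have e'0 : 0 < e' by rewrite divr_gt0.
have [ra ra0 sma] := boundary_small t (a t) e' t0 (or_introl erefl) e'0.
have [rb rb0 smb] := boundary_small t (b t) e' t0 (or_intror erefl) e'0.
pose r := Num.min ra rb.
have r0 : 0 < r by rewrite lt_min ra0.
have {}sma : small_near t (a t) e' r.
  by move=> s y; rewrite !lt_min => /andP[? _] /andP[? _]; exact: sma.
have {}smb : small_near t (b t) e' r.
  by move=> s y; rewrite !lt_min => /andP[_ ?] /andP[_ ?]; exact: smb.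
have [rl /= rl0 lip] : exists2 rl : R, 0 < rl & forall s : R, `|s - t| < rl ->
    0 <= s -> `|a s - a t| <= K * `|s - t| /\ `|b s - b t| <= K * `|s - t|.
  have : \forall s \near t, (0 <= s -> `|a s - a t| <= Ka * `|s - t|) /\
      (0 <= s -> `|b s - b t| <= Kb * `|s - t|) by apply: filterS2 lipa lipb.
  move=> /nbhs_ballP[rl /= rl0 lip].
  exists rl => // s st s0; have [] := lip s; first by rewrite /ball/= distrC.
  move=> /(_ s0) ha /(_ s0) hb; split.
    by apply: le_trans ha _; rewrite ler_wpM2r// lerDl.
  by apply: le_trans hb _; rewrite ler_wpM2r// lerDr.
(* The three constraints on the time step: the Lipschitz bounds are valid, the layers stay within
   distance [r] of the boundary point, and the middle segment is nondegenerate. *)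
pose m := Num.min rl (Num.min (r / (K + 1)) ((b t - a t) / (2 * (K + 1)))).
have K1 : 0 < K + 1 by lra.
have m0 : 0 < m.
  by rewrite !lt_min rl0 divr_gt0//= divr_gt0 ?mulr_gt0// subr_gt0 ab.
have main (s1 s2 : R) : 0 <= s1 -> s1 < s2 -> s1 <= t <= s2 -> s2 - s1 < m ->
    `|region_mass s2 - region_mass s1| <= e * (s2 - s1).
  move=> s10 s12 /andP[s1t ts2].
  rewrite !lt_min => /andP[h1 /andP[]].
  rewrite !ltr_pdivlMr ?mulr_gt0// => h2 h3.
  have -> : e = e' * (8 * K + 6) by rewrite /e' divfK// gt_eqF.
  have near (s : R) : s1 <= s <= s2 -> `|s - t| <= s2 - s1.
    by move=> /andP[? ?]; rewrite ler_norml; apply/andP; split; lra.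
  apply: (mass_variation t s1 s2 K e' r) => //; first by rewrite s1t.
  - move=> s hs; have /andP[? _] := hs; have hn := near s hs.
    have [|//|+ _] := lip s; first exact: le_lt_trans h1.
      exact: le_trans s10 _.
    by move=> ha; apply: le_trans ha _; rewrite ler_wpM2l.
  - move=> s hs; have /andP[? _] := hs; have hn := near s hs.
    have [|//|_ +] := lip s; first exact: le_lt_trans h1.
      exact: le_trans s10 _.
    by move=> ha; apply: le_trans ha _; rewrite ler_wpM2l.
  - by rewrite mulrC.
  - by rewrite mulrA mulrC.
(* [main] is used with [t] as the left or the right end of the time interval, according to the side
   on which [s] lies. *)
apply/nbhs_ballP; exists m => //= s; rewrite /ball/= => st s0.
have [ts|ts|->] := ltgtP t s; last by rewrite !subrr !normr0 mulr0.
- rewrite [`|s - t|]gtr0_norm ?subr_gt0//; apply: main => //; first by rewrite lexx ltW.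
  by move: st; rewrite distrC gtr0_norm ?subr_gt0.
- rewrite distrC [`|s - t|]distrC [`|t - s|]gtr0_norm ?subr_gt0//.
  apply: main => //; first by rewrite lexx ltW.
  by move: st; rewrite gtr0_norm ?subr_gt0.
Qed.

Lemma region_mass_conserved (t : R) : 0 <= t -> region_mass t = region_mass 0.
Proof.
move=> t0.
(* Constant extension to negative times: t = 0 needs no one-sided derivative. *)
pose N (s : R) := region_mass (Num.max 0 s).
suff dN (s : R) : is_derive s 1 N 0.
  by have := @is_derive_0_is_cst _ N t 0 dN; rewrite /N max_r// maxxx.
have cN : h^-1 *: (N (h + s) - N s) @[h --> 0^'] --> 0.
  apply/cvgrPdist_le => e e0.
  have s0 : 0 <= Num.max 0 s by rewrite le_max lexx.
  have := mass_variation_near (Num.max 0 s) e s0 e0.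
  move=> /nbhs_ballP[m /= m0 hm].
  near=> h.
  have h0 : h != 0 by near: h; exact: nbhs_dnbhs_neq.
  have hhm : `|h| < m by near: h; exact: dnbhs0_lt.
  have max_lip : `|Num.max 0 (h + s) - Num.max 0 s| <= `|h|.
    by rewrite (le_trans (normr_max0B _ _ _))// addrK.
  rewrite sub0r normrN normrZ normfV ler_pdivrMl ?normr_gt0// mulrC.
  apply: le_trans (hm (Num.max 0 (h + s)) _ _) _.
  - by rewrite /ball/= distrC (le_lt_trans max_lip).
  - by rewrite le_max lexx.
  - by rewrite ler_wpM2l// ltW.
split; last by apply: cvg_lim => //; under eq_fun do rewrite -[_ *: 1]/(_ * 1) mulr1.
by apply/cvg_ex; exists 0; under eq_fun do rewrite -[_ *: 1]/(_ * 1) mulr1.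
Unshelve. all: by end_near.
Qed.

End moving_interval.

(** * One-sided derivatives and difference quotients *)

Section within_derivative.
Context {R : realType}.
Implicit Types (f a b : R -> R) (A : set R).

(** Near [t] the difference quotient is within 1 of its limit [L], hence bounded by [|L| + 1]. Since
    [t < T], all nonnegative times close to [t] lie in [[0, T]]. *)
Lemma derivable_within_locally_lipschitz f (t T : R) : 0 <= t < T ->
  derivable_within `[0, T] f t -> locally_lipschitz f t.
Proof.
move=> /andP[t0 tT]; rewrite /derivable_within.
set L := lim _ => /cvgrPdist_le/(_ 1 ltr01) hL.
have {}hL : nbhs t [set z | z != t -> `[0, T]%classic z ->
    `|L - (f z - f t) / (z - t)| <= 1] by exact: hL.
exists (`|L| + 1); first by rewrite addr_ge0.
have zT : \forall z \near t, z < T by exact: lt_nbhsl.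
apply: filterS2 hL zT => z /= hz zT z0.
have [->|zt] := eqVneq z t; first by rewrite !subrr !normr0 mulr0.
have := hz zt; rewrite in_itv/= z0 ltW// => /(_ isT) hd.
rewrite -ler_pdivrMr ?normr_gt0 ?subr_eq0// -normf_div.
have -> : (f z - f t) / (z - t) = L - (L - (f z - f t) / (z - t)).
  by rewrite subKr.
by rewrite (le_trans (ler_normB _ _))// lerD2l.
Qed.

Lemma locally_lipschitz_near f (t e : R) : locally_lipschitz f t -> 0 < e ->
  \forall s \near t, 0 <= s -> `|f s - f t| < e.
Proof.
move=> [K K0 lip] e0.
(* Dividing by [K + 1] covers the case [K = 0]. *)
have K1 : 0 < e / (K + 1) by rewrite divr_gt0// ltr_wpDl.
have hb : \forall s \near t, `|s - t| < e / (K + 1).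
  by apply/nbhs_ballP; exists (e / (K + 1)) => //= s; rewrite /ball/= distrC.
apply: filterS2 lip hb => s lip hb /lip h.
apply: le_lt_trans h _.
rewrite ltr_pdivlMr in hb; last by rewrite ltr_wpDl.
by apply: le_lt_trans hb; rewrite mulrC ler_wpM2l// lerDl.
Qed.

(** The substitution [z = x + h] relates the quotient used for derivatives within a set to the one
    behind [is_derive]. *)
Lemma quotient_is_derive f (x L : R) :
  (f z - f x) / (z - x) @[z --> x^'] --> L <-> is_derive x 1 f L.
Proof.
have hE : (h^-1 *: (f (h + x) - f x) @[h --> 0^'] --> L) <->
    (f z - f x) / (z - x) @[z --> x^'] --> L.
  split=> /cvgrPdist_le H; apply/cvgrPdist_le => e e0; have := H e e0;
    move=> /nbhs_ballP[r /= r0 hr]; apply/nbhs_ballP; exists r => // z;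
    rewrite /ball/= => zr zx.
  - have := hr (z - x); rewrite /ball/= sub0r normrN distrC => /(_ zr).
    by rewrite subr_eq0 => /(_ zx); rewrite subrK [_^-1 *: _]mulrC.
  - have := hr (z + x); rewrite /ball/= opprD addrCA subrr addr0.
    rewrite sub0r in zr => /(_ zr); rewrite -subr_eq0 addrK => /(_ zx).
    by rewrite [_^-1 *: _]mulrC.
have E : (fun h : R => h^-1 *: ((f \o shift x) (h *: (1 : R)) - f x)) =
    (fun h => h^-1 *: (f (h + x) - f x)).
  by apply/funext => h /=; rewrite -[h *: 1]/(h * 1) mulr1.
split=> [/hE H|[dv DL]].
  split; last by rewrite /derive E; exact: cvg_lim.
  by rewrite /derivable E; apply/cvg_ex; exists L.
by apply/hE; rewrite -DL /derive -E; exact: dv.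
Qed.

Lemma quotient_within_nbhs A f (t : R) : nbhs t A ->
  quotient_within A f t = ((f z - f t) / (z - t) @[z --> t^']).
Proof.
move=> At; rewrite /quotient_within; apply/funext => W; apply/propext.
have -> : within A t^' = t^'.
  apply/funext => V; apply/propext; split => H.
    have H' : nbhs t [set z | z != t -> A z -> V z] by [].
    by apply: filterS2 H' At => z /= H1 Az zt; exact: H1.
  by apply: filterS H => z /= Vz _.
by [].
Qed.

End within_derivative.

(** * Regularity of the solution in the moving domain and at its boundary *)

Section solution.
Context {R : realType}.
Variables (alpha : R) (rho0 u0 a b : R -> R) (rho u : R -> R -> R).
Hypothesis hsol : global_classical_solution a b alpha rho0 u0 rho u.

Local Notation O := (open_region a b).
Local Notation D := (closed_region a b).

Let solution_on (T : R) : 0 < T -> classical_solution a b T rho0 u0 rho u.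
Proof. by move=> /hsol[]. Qed.

(** At time [t] the solution is taken with horizon [t + 1], so that [t] is never the final time. *)
Let succ_gt0 (t : R) : 0 <= t -> 0 < t + 1.
Proof. by move=> t0; rewrite ltr_wpDl. Qed.

Let ab (t : R) : 0 <= t -> a t < b t.
Proof.
by move=> t0; apply: (cs_interval (solution_on _ (succ_gt0 t t0)));
  rewrite t0 lerDl ler01.
Qed.

Let lip_a (t : R) : 0 <= t -> locally_lipschitz a t.
Proof.
move=> t0; apply: (@derivable_within_locally_lipschitz _ _ _ (t + 1)).
  by rewrite t0 ltrDl ltr01.
have [[+ _ _] _] := cs_C2 (solution_on _ (succ_gt0 t t0)); apply.
by rewrite /= in_itv/= t0 lerDl ler01.
Qed.

Let lip_b (t : R) : 0 <= t -> locally_lipschitz b t.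
Proof.
move=> t0; apply: (@derivable_within_locally_lipschitz _ _ _ (t + 1)).
  by rewrite t0 ltrDl ltr01.
have [_ [+ _ _]] := cs_C2 (solution_on _ (succ_gt0 t t0)); apply.
by rewrite /= in_itv/= t0 lerDl ler01.
Qed.

Let between_near (t y : R) : 0 <= t -> a t < y < b t ->
  \forall s \near t, 0 <= s -> a s < y < b s.
Proof.
move=> t0 /andP[ay yb].
have ha := locally_lipschitz_near _ _ (y - a t) (lip_a t t0).
have hb := locally_lipschitz_near _ _ (b t - y) (lip_b t t0).
rewrite !subr_gt0 in ha hb; move: (ha ay) (hb yb) => {}ha {}hb.
apply: filterS2 ha hb => s ha hb s0; move: (ha s0) (hb s0).
by rewrite !ltr_norml => /andP[? ?] /andP[? ?]; apply/andP; split; lra.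
Qed.

Let near_O (t y : R) : O (t, y) -> nbhs (t, y) O.
Proof.
move=> [/= t0 /andP[ay yb]].
(* Both [y - m] and [y + m] lie between the endpoints at time [t], hence also at nearby times, and
   then so does every point between them. *)
pose m := Num.min (y - a t) (b t - y) / 2.
have m0 : 0 < m by rewrite divr_gt0// lt_min !subr_gt0 ay.
have ym : a t < y - m /\ y + m < b t.
  have hm : m < Num.min (y - a t) (b t - y).
    by rewrite /m ltr_pdivrMr// ltr_pMr ?ltr1n// lt_min !subr_gt0 ay.
  by move: hm; rewrite lt_min => /andP[? ?]; split; lra.
have h1 : a t < y - m < b t by apply/andP; split; lra.
have h2 : a t < y + m < b t by apply/andP; split; lra.
have h0 : \forall s \near t, 0 < s by exact: lt_nbhsr.
have : \forall s \near t, [/\ 0 < s, a s < y - m & y + m < b s].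
  apply: filterS3 h0 (between_near t _ (ltW t0) h1) (between_near t _ (ltW t0) h2).
  by move=> s s0 /(_ (ltW s0))/andP[? _] /(_ (ltW s0))/andP[_ ?].
move=> /nbhs_ballP[r /= r0 hr].
apply/nbhs_ballP; exists (Num.min r m); first by rewrite /= lt_min r0.
move=> [s z] [/= hs hz].
have [s0 ? ?] : [/\ 0 < s, a s < y - m & y + m < b s].
  by apply: hr; apply: le_ball hs; rewrite ge_min lexx.
split => //=; have : `|y - z| < m.
  by move: hz; rewrite /ball/= lt_min => /andP[].
by rewrite ltr_norml => /andP[? ?]; apply/andP; split; lra.
Qed.

Let O_IT (T : R) p : O p -> p.1 <= T -> IT a b T p.
Proof. by move=> [p0 hp] pT; split; rewrite ?p0//= in_itv. Qed.

Let IT_O (T : R) p : IT a b T p -> O p.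
Proof. by move=> [/andP[p0 _]]; rewrite /It/= in_itv/=. Qed.

Let near_IT (t y : R) : O (t, y) -> nbhs (t, y) (IT a b (t + 1)).
Proof.
move=> Oty.
have h : nbhs (t, y) [set p : R * R | p.1 < t + 1].
  apply: (@cvg_fst _ _ (nbhs t) (nbhs y) _ [set s : R | s < t + 1]).
  by apply: lt_nbhsl; rewrite ltrDl.
by apply: filterS2 (near_O _ _ Oty) h => p Op /= /ltW; exact: O_IT.
Qed.

(** The point is first moved in space to some [y'] strictly between the endpoints, then forward in
    time by a small [h]. The forward move is what reaches [t = 0], and it needs [t < T]. *)
Let closure_IT (T t y : R) : 0 <= t < T -> a t <= y <= b t ->
  closure (IT a b T) (t, y).
Proof.
move=> /andP[t0 tT] /andP[ay yb] W /nbhs_ballP[r /= r0 hr].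
have abt := ab t t0.
have [y' hy' yy'] : exists2 y', a t < y' < b t & `|y - y'| < r.
  pose m := Num.min (b t - a t) r / 2.
  have m0 : 0 < m by rewrite divr_gt0// lt_min subr_gt0 abt.
  have : m < Num.min (b t - a t) r.
    by rewrite /m ltr_pdivrMr// ltr_pMr ?ltr1n// lt_min subr_gt0 abt.
  rewrite lt_min => /andP[mab mr].
  have [ya|ya] := leP y (a t); last have [yb'|yb'] := leP (b t) y.
  - exists (a t + m); first by apply/andP; split; lra.
    by rewrite ltr_norml; apply/andP; split; lra.
  - exists (b t - m); first by apply/andP; split; lra.
    by rewrite ltr_norml; apply/andP; split; lra.
  - by exists y; rewrite ?ya// subrr normr0.
have /nbhs_ballP[q /= q0 hq] := between_near t y' t0 hy'.
pose h := Num.min q (Num.min r (T - t)) / 2.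
have hm0 : 0 < Num.min q (Num.min r (T - t)) by rewrite !lt_min q0 r0 subr_gt0.
have h0 : 0 < h by rewrite divr_gt0.
have : h < Num.min q (Num.min r (T - t)) by rewrite /h ltr_pdivrMr// ltr_pMr ?ltr1n.
rewrite !lt_min => /and3P[hq' hr' hT].
have th : 0 <= t + h by rewrite addr_ge0// ltW.
have tth : `|t - (t + h)| = h by rewrite opprD addNKr normrN gtr0_norm.
exists (t + h, y'); split.
  split => /=; first by apply/andP; split; lra.
  by rewrite /It/= in_itv/=; apply: hq => //; rewrite /ball/= tth.
by apply: hr; split => //; rewrite /ball/= tth.
Qed.

(** Continuity is local: near time [t] the region without final time is contained in the closure of
    [IT a b (t + 1)]. *)
Let within_D (g : R * R -> R) :
  (forall T : R, 0 < T -> {within closure (IT a b T), continuous g}) ->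
  {within D, continuous g}.
Proof.
move=> cg; apply/subspace_continuousP => -[t y] [/= t0 hy] W /= NW.
have T0 := succ_gt0 t t0.
have cl : closure (IT a b (t + 1)) (t, y).
  by apply: closure_IT; rewrite // t0 ltrDl ltr01.
have /subspace_continuousP/(_ _ cl)/(_ W NW) := cg _ T0.
move=> h.
have {}h : nbhs (t, y) [set p | closure (IT a b (t + 1)) p -> W (g p)].
  by exact: h.
have h' : nbhs (t, y) [set p : R * R | p.1 < t + 1].
  apply: (@cvg_fst _ _ (nbhs t) (nbhs y) _ [set s : R | s < t + 1]).
  by apply: lt_nbhsl; rewrite ltrDl.
suff : nbhs (t, y) [set p | D p -> W (g p)] by [].
apply: filterS2 h h' => -[s z] /= h' sT [/= s0 hz]; apply: h'.
by apply: closure_IT; rewrite // s0.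
Qed.

Let c_rho : {within D, continuous (fun p => rho p.1 p.2)}.
Proof. by apply: within_D => T /solution_on /cs_rho. Qed.

Let c_u : {within D, continuous (fun p => u p.1 p.2)}.
Proof. by apply: within_D => T /solution_on /cs_u. Qed.

Let O_D p : O p -> D p.
Proof. by move=> [p0 /andP[? ?]]; split; rewrite ?ltW//= !ltW. Qed.

Let interior_continuous (g : R * R -> R) t y : {within D, continuous g} ->
  O (t, y) -> {for (t, y), continuous g}.
Proof.
move=> /subspace_continuousP cg Oty W NW.
have : nbhs (t, y) [set p | D p -> W (g p)] by exact: (cg _ (O_D _ Oty) W NW).
move=> h; suff : nbhs (t, y) [set p | W (g p)] by [].
by apply: filterS2 h (near_O _ _ Oty) => p h /O_D.
Qed.

Let times_nbhs (T t y : R) : O (t, y) -> t < T -> nbhs t (times a b T y).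
Proof.
move=> [/= t0 hy] tT.
have h0 : \forall s \near t, 0 < s < T.
  by near=> s; apply/andP; split; near: s; [exact: lt_nbhsr|exact: lt_nbhsl].
apply: filterS2 h0 (between_near t y (ltW t0) hy) => s /andP[s0 sT] /(_ (ltW s0)) hs.
by split; rewrite ?(ltW s0) ?(ltW sT)//= /It/= in_itv.
Unshelve. all: by end_near.
Qed.

Let dt_is_derive (T : R) (f : R -> R -> R) (t y l : R) : O (t, y) -> t < T ->
  is_derive t 1 (f^~ y) l -> dt a b T f t y = l.
Proof.
move=> Oty tT /quotient_is_derive H.
by rewrite /dt /derive_within quotient_within_nbhs; [exact: cvg_lim|exact: times_nbhs].
Qed.

Let is_derive_dt (T : R) (f : R -> R -> R) (t y : R) : O (t, y) -> t < T ->
  t_derivable a b T f -> is_derive t 1 (f^~ y) (dt a b T f t y).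
Proof.
move=> Oty tT df; have := df _ _ (O_IT _ _ Oty (ltW tT)).
rewrite /derivable_within /dt /derive_within quotient_within_nbhs; last first.
  exact: times_nbhs.
by move=> H; apply/quotient_is_derive.
Qed.

(** Unlike [dt], it does not depend on a horizon, so one function serves for all times. The two
    agree at interior points before the horizon. *)
Definition partial_t (f : R -> R -> R) (t y : R) : R := derive1 (f^~ y) t.

Let partial_tE (T : R) (f : R -> R -> R) (t y : R) : O (t, y) -> t < T ->
  t_derivable a b T f -> dt a b T f t y = partial_t f t y.
Proof.
move=> Oty tT df; have [_ <-] := is_derive_dt _ _ _ _ Oty tT df.
by rewrite /partial_t derive1E.
Qed.

Let is_derive_t (f : R -> R -> R) (t y : R) : O (t, y) ->
  t_derivable a b (t + 1) f -> is_derive t 1 (f^~ y) (partial_t f t y).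
Proof.
move=> Oty df; have tT : t < t + 1 by rewrite ltrDl.
by rewrite -(partial_tE _ _ _ _ Oty tT df); exact: is_derive_dt.
Qed.

(** The continuous extension of [dt] coincides with [partial_t f] on a whole neighbourhood of an
    interior point. *)
Let partial_t_continuous (f : R -> R -> R) (t y : R) : O (t, y) ->
  t_derivable a b (t + 1) f -> C_closure a b (t + 1) (dt a b (t + 1) f) ->
  {for (t, y), continuous (fun p => partial_t f p.1 p.2)}.
Proof.
move=> Oty df [g /subspace_continuousP cg gE].
have tT : t < t + 1 by rewrite ltrDl.
have ITty : IT a b (t + 1) (t, y) by apply: O_IT => //=; exact: ltW.
have nI := near_IT _ _ Oty.
have nT : nbhs (t, y) [set p : R * R | p.1 < t + 1].
  by apply: (@cvg_fst _ _ (nbhs t) (nbhs y) _ [set s : R | s < t + 1]); exact: lt_nbhsl.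
have gp s z : IT a b (t + 1) (s, z) -> s < t + 1 -> g (s, z) = partial_t f s z.
  by move=> hI sT; rewrite gE// (partial_tE _ _ _ _ (IT_O _ _ hI) sT).
move=> W /= NW; rewrite -gp// in NW.
have : nbhs (t, y) [set p | closure (IT a b (t + 1)) p -> W (g p)].
  exact: (cg _ (subset_closure ITty) W NW).
move=> h; suff : nbhs (t, y) [set p | W (partial_t f p.1 p.2)] by [].
apply: filterS3 h nI nT => -[s z] /= h hI sT.
by rewrite -gp//; exact: h (subset_closure hI).
Qed.

Let is_derive_y (f : R -> R -> R) (t y : R) : O (t, y) ->
  y_derivable a b (t + 1) f -> is_derive y 1 (f t) (dy f t y).
Proof.
move=> Oty df; split; last by rewrite /dy derive1E.
by apply: df; apply: O_IT => //=; rewrite lerDl.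
Qed.

Lemma density_boundary (t z : R) : 0 <= t -> z = a t \/ z = b t -> rho t z = 0.
Proof.
move=> t0 hz; apply: (cs_vacuum (solution_on _ (succ_gt0 t t0))) => //.
by rewrite t0 lerDl ler01.
Qed.

Let boundary_D (t z : R) : 0 <= t -> z = a t \/ z = b t -> D (t, z).
Proof. by move=> t0 zab; split => //=; case: zab => ->; rewrite lexx ltW ?ab. Qed.

Let boundary_cvg (g : R * R -> R) (t z : R) : 0 <= t -> z = a t \/ z = b t ->
  {within D, continuous g} -> g p @[p --> within O (nbhs (t, z))] --> g (t, z).
Proof.
move=> t0 zab /subspace_continuousP/(_ _ (boundary_D _ _ t0 zab)) cg W NW.
have h : nbhs (t, z) [set p | D p -> W (g p)] by exact: cg W NW.
suff : nbhs (t, z) [set p | O p -> W (g p)] by [].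
by apply: filterS h => p /= h /O_D.
Qed.

Let uy_boundary (t z : R) : 0 <= t -> z = a t \/ z = b t ->
  dy u p.1 p.2 @[p --> within O (nbhs (t, z))] --> (0 : R).
Proof.
move=> t0 zab W NW.
have [_ _ /(_ t z)] := hsol _ (succ_gt0 t t0).
rewrite t0 lerDl ler01 => /(_ isT zab) /(_ W NW) h.
have {}h : nbhs (t, z) [set p | IT a b (t + 1) p -> W (dy u p.1 p.2)] by exact: h.
have nT : nbhs (t, z) [set p : R * R | p.1 < t + 1].
  apply: (@cvg_fst _ _ (nbhs t) (nbhs z) _ [set s : R | s < t + 1]).
  by apply: lt_nbhsl; rewrite ltrDl.
suff : nbhs (t, z) [set p | O p -> W (dy u p.1 p.2)] by [].
by apply: filterS2 h nT => p h /= pT Op; apply: h; apply: O_IT => //; exact: ltW.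
Qed.

(** * Conservation of mass and momentum *)

Lemma mass_conserved (t : R) : 0 <= t ->
  region_mass a b rho t = region_mass a b rho 0.
Proof.
apply: (@region_mass_conserved _ a b rho (partial_t rho)
  (fun s z => rho s z * u s z)) => //.
- move=> s y Osy; have s0 := ltW Osy.1; apply: is_derive_t => //.
  by have [] := cs_rho_t (solution_on _ (succ_gt0 s s0)).
- move=> s y Osy; have s0 := ltW Osy.1.
  by have [] := cs_rho_t (solution_on _ (succ_gt0 s s0)); exact: partial_t_continuous.
- move=> s y Osy; have s0 := ltW Osy.1.
  have S := solution_on _ (succ_gt0 s s0).
  have sT : s < s + 1 by rewrite ltrDl.
  have hI : IT a b (s + 1) (s, y) by apply: O_IT => //=; exact: ltW.
  have dr := is_derive_y _ _ _ Osy (cs_rho_y S).1.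
  have du := is_derive_y _ _ _ Osy (cs_u_y S).1.
  have dru := is_deriveM dr du.
  have := cs_mass S hI; rewrite (partial_tE _ _ _ _ Osy sT (cs_rho_t S).1).
  move=> /eqP; rewrite addrC addr_eq0 /dy derive1E => /eqP <-.
  apply: DeriveDef; [by case: dru|by []].
- exact: density_boundary.
- move=> s z s0 zab.
  have cr := boundary_cvg _ _ _ s0 zab c_rho.
  have cu := boundary_cvg _ _ _ s0 zab c_u.
  have <- : rho s z * u s z = 0 by rewrite (density_boundary _ _ s0 zab) mul0r.
  by apply: cvgM; [exact: cr|exact: cu].
Qed.

Lemma momentum_conserved (t : R) : 0 <= t ->
  region_mass a b (fun s y => rho s y * u s y) t =
  region_mass a b (fun s y => rho s y * u s y) 0.
Proof.
(* The time derivative of [rho * u] is written by the product rule, in terms of functions already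
   known to be continuous in the interior. *)
pose ft s y := rho s y * partial_t u s y + u s y * partial_t rho s y.
have dft s y : O (s, y) -> is_derive s 1 ((fun s y => rho s y * u s y)^~ y) (ft s y).
  move=> Osy; have s0 := ltW Osy.1.
  have S := solution_on _ (succ_gt0 s s0).
  exact: is_deriveM (is_derive_t _ _ _ Osy (cs_rho_t S).1)
    (is_derive_t _ _ _ Osy (cs_u_t S).1).
apply: (@region_mass_conserved _ a b _ ft
  (fun s z => rho s z * u s z ^+ 2 + rho s z ^+ 2 - rho s z * dy u s z)) => //.
- apply/subspace_continuousP => p Dp.
  by apply: cvgM;
    [move/subspace_continuousP: c_rho|move/subspace_continuousP: c_u]; exact.
- move=> s y Osy; have s0 := ltW Osy.1.
  have S := solution_on _ (succ_gt0 s s0).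
  have c1 := interior_continuous _ _ _ c_rho Osy.
  have c2 := interior_continuous _ _ _ c_u Osy.
  have c3 := partial_t_continuous _ _ _ Osy (cs_rho_t S).1 (cs_rho_t S).2.
  have c4 := partial_t_continuous _ _ _ Osy (cs_u_t S).1 (cs_u_t S).2.
  exact: cvgD (cvgM c1 c4) (cvgM c2 c3).
- move=> s y Osy; have s0 := ltW Osy.1.
  have S := solution_on _ (succ_gt0 s s0).
  have sT : s < s + 1 by rewrite ltrDl.
  have hI : IT a b (s + 1) (s, y) by apply: O_IT => //=; exact: ltW.
  have dr := is_derive_y _ _ _ Osy (cs_rho_y S).1.
  have du := is_derive_y _ _ _ Osy (cs_u_y S).1.
  have duy := is_derive_y _ _ _ Osy (cs_u_yy S).1.
  have d1 := is_deriveD (is_deriveM dr (is_deriveX 2 du)) (is_deriveX 2 dr).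
  have d2 := is_deriveM dr duy.
  have d12 := is_deriveB d1 d2.
  have := cs_momentum S hI; rewrite (dt_is_derive _ _ _ _ _ Osy sT (dft _ _ Osy)).
  rewrite /dy !derive1E => E.
  apply: DeriveDef; first by case: d12.
  rewrite deriveB; [|by case: d1|by case: d2].
  by move/eqP: E; rewrite -addrA addr_eq0 => /eqP ->; rewrite opprK.
- by move=> s z s0 zab; rewrite density_boundary// mul0r.
- move=> s z s0 zab.
  have cr := boundary_cvg _ _ _ s0 zab c_rho.
  have cu := boundary_cvg _ _ _ s0 zab c_u.
  have cy := uy_boundary _ _ s0 zab.
  (* Every term of the flux has a factor [rho] tending to 0, and the other factors have finite
     limits: [u] by continuity up to the boundary, [dy u] by its boundary condition. *)
  have <- : rho s z * (u s z * u s z) + rho s z * rho s z - rho s z * 0 = 0.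
    by rewrite (density_boundary _ _ s0 zab) !mul0r addr0 subr0.
  apply: cvgB; last by apply: cvgM; [exact: cr|exact: cy].
  apply: cvgD; last by apply: cvgM; exact: cr.
  apply: cvgM; first exact: cr.
  by apply: cvgM; exact: cu.
Qed.

(** * Slices at fixed time and the initial momentum *)

Lemma density_ge0 (t y : R) : 0 < t -> a t <= y <= b t -> 0 <= rho t y.
Proof.
move=> t0 /andP[]; rewrite le_eqVlt => /predU1P[<- _|ay].
  by rewrite (density_boundary _ _ (ltW t0) (or_introl erefl)).
rewrite le_eqVlt => /predU1P[->|yb].
  by rewrite (density_boundary _ _ (ltW t0) (or_intror erefl)).
apply/ltW/(cs_rho_gt0 (solution_on t t0)).
by split; [rewrite /= t0 lexx|rewrite /It/= in_itv/= ay].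
Qed.

Lemma density_slice_continuous (t : R) : 0 <= t ->
  {within `[a t, b t], continuous (rho t)}.
Proof. by move=> t0; exact: (region_slice_continuous _ _ _ c_rho t t0). Qed.

Lemma velocity_slice_continuous (t : R) : 0 <= t ->
  {within `[a t, b t], continuous (u t)}.
Proof. by move=> t0; exact: (region_slice_continuous _ _ _ c_u t t0). Qed.

(** The initial data are attained on the open interval only, and the two endpoints do not contribute
    to the integral. *)
Lemma initial_momentum :
  Rintegral lebesgue_measure unit_itv (fun y => rho0 y * u0 y) =
  region_mass a b (fun s y => rho s y * u s y) 0.
Proof.
have S := solution_on 1 ltr01.
have [a0 b0] := cs_init_interval S.
have init := cs_init S.
have c01 : {within `[0, 1], continuous (fun y => rho 0 y * u 0 y)}.
  have := density_slice_continuous 0 (lexx 0).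
  have := velocity_slice_continuous 0 (lexx 0).
  rewrite a0 b0 => /subspace_continuousP cu /subspace_continuousP cr.
  apply/subspace_continuousP => y hy.
  by apply: cvgM; [exact: cr|exact: cu].
have i01 := continuous_segment_integrable _ _ _ c01.
rewrite /region_mass a0 b0 -Rintegral_itv_bndo_bndc; last first.
  by apply: integrableS i01 => //; exact: subset_itv_co_cc.
rewrite -Rintegral_itv_obnd_cbnd; last first.
  by apply: integrableS i01 => //; exact: subset_itv_oo_cc.
apply: eq_Rintegral => y /set_mem; rewrite /unit_itv/= => hy.
by have [|-> ->] := init y; rewrite // /It/= a0 b0.
Qed.

End solution.

(** * Momentum against mass times maximal speed *)

Theorem theorem1p5 (R : realType) (alpha eps0 : R) (rho0 u0 : R -> R)
    (a b : R -> R) (rho u : R -> R -> R)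
    (halpha : 3^-1 < alpha <= 1)
    (heps0 : eps0_admissible alpha eps0)
    (hrho0_ge0 : forall y, 0 <= y <= 1 -> 0 <= rho0 y)
    (hrho0_H3 : (sobolev_norm 3 2 unit_itv (fun y => (rho0 y `^ alpha)%R) < +oo)%E)
    (hrho0_dist : exists C1 C2 : R, [/\ 0 < C1, 0 < C2 &
       forall y, 0 <= y <= 1 ->
         C1 * dist_bd y <= rho0 y `^ alpha <= C2 * dist_bd y])
    (henergy : finite_initial_energy rho0 u0 alpha eps0)
    (hsol : global_classical_solution a b alpha rho0 u0 rho u)
    (hmomentum : 0 < `| Rintegral lebesgue_measure unit_itv
                          (fun y => rho0 y * u0 y) |) :
  ~ (limf_esup (fun t : R => ereal_sup [set (`|u t y|%R)%:E | y in It a b t])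
       (+oo%R : set_system R) = 0%E).
Proof.
set P := Rintegral _ _ _ in hmomentum => lim0.
pose m := region_mass a b rho 0.
have m_ge0 : 0 <= m.
  (* The sign of the mass is read off at time 1, because [density_ge0] concerns positive times. *)
  rewrite /m -(mass_conserved _ _ _ _ _ _ _ hsol 1)//.
  apply: Rintegral_ge0 => y; rewrite /= in_itv/=.
  by apply: density_ge0 hsol _ _ _.
(* This speed makes [e * m < |P|]; the added 1 covers [m = 0]. *)
pose e := `|P| / (m + 1).
have m1 : 0 < m + 1 by rewrite ltr_wpDl.
have e0 : 0 < e by rewrite divr_gt0.
have [t t0 ut] : exists2 t, 0 < t & forall y, a t < y < b t -> `|u t y| <= e.
  have : (limf_esup (fun t : R => ereal_sup [set (`|u t y|%R)%:E | y in It a b t])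
       (+oo%R : set_system R) < e%:E)%E by rewrite lim0 lte_fin.
  (* A limit superior below [e] means that the supremum over some neighbourhood of infinity is below
     [e]. The time [|M| + 1] is positive and belongs to that neighbourhood. *)
  rewrite limf_esupE => /ereal_inf_lt[_ [V [M [Mr MV]] <-]] ltVe.
  pose t := `|M| + 1.
  exists t; first by rewrite ltr_wpDl.
  move=> y hy; rewrite -lee_fin ltW//.
  apply: le_lt_trans ltVe.
  apply: (@le_trans _ _ (ereal_sup [set (`|u t y|%R)%:E | y in It a b t])).
    by apply: ereal_sup_ubound; exists y => //; rewrite /It/= in_itv.
  apply: ereal_sup_ubound; exists t => //; apply: MV.
  by rewrite (le_lt_trans (ler_norm M))// ltrDl.
have t0' := ltW t0.
have PE : P = region_mass a b (fun s y => rho s y * u s y) t.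
  by rewrite (momentum_conserved _ _ _ _ _ _ _ hsol)//; exact: initial_momentum hsol.
have cr := density_slice_continuous _ _ _ _ _ _ _ hsol t t0'.
have cu := velocity_slice_continuous _ _ _ _ _ _ _ hsol t t0'.
have cru : {within `[a t, b t], continuous (fun y => rho t y * u t y)}.
  by apply/subspace_continuousP => y hy;
    apply: cvgM; [move/subspace_continuousP: cr|move/subspace_continuousP: cu]; exact.
have : `|P| <= e * m.
  rewrite PE /m -(mass_conserved _ _ _ _ _ _ _ hsol t t0') /region_mass.
  rewrite -RintegralZl//; last exact: continuous_segment_integrable.
  apply: le_trans (le_normr_Rintegral _ _) _ => //.
    exact: continuous_segment_integrable.
  apply: le_Rintegral => //=.
  - by apply: integrable_norm; exact: continuous_segment_integrable.
  - apply: continuous_segment_integrable.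
    apply/subspace_continuousP => y hy; apply: cvgM; first exact: cvg_cst.
    by move/subspace_continuousP: cr; exact.
  - move=> y; rewrite in_itv/= => hy.
    have r0 : 0 <= rho t y by apply: (density_ge0 _ _ _ _ _ _ _ hsol).
    rewrite normrM (ger0_norm r0).
    (* The bound on [u] holds on the open interval only. At the endpoints the density vanishes, so
       where it is nonzero the point is interior. *)
    have [->|rn0] := eqVneq (rho t y) 0; first by rewrite mul0r mulr0.
    rewrite mulrC ler_wpM2r//; apply: ut; move: hy => /andP[].
    have b0 z : z = a t \/ z = b t -> rho t z = 0.
      exact: (density_boundary _ _ _ _ _ _ _ hsol).
    rewrite !le_eqVlt => /predU1P[ya|->]; first by rewrite b0 ?eqxx// in rn0; left.
    by move=> /predU1P[yb|//]; rewrite b0 ?eqxx// in rn0; right.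
rewrite leNgt => /negP; apply.
by rewrite /e mulrAC ltr_pdivrMr// ltr_pM2l// ltrDl.
Qed.
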